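(* Let $(\mathcal{A},[\cdot,\cdot],\circ,\alpha)$ be a super Hom-Gel'fand-Dorfman bialgebra, let $(\mathcal{R},[\cdot_\lambda\cdot],\alpha)$ be the quadratic Hom-Lie conformal superalgebra associated to it, and let $\hat{\mathcal{R}}=\mathcal{R}\oplus\mathbb{C}\mathfrak{c}$ be a one-dimensional central extension of $\mathcal{R}$ with $\lambda$-bracket determined by $$\widehat{[u_\lambda v]}=[v,u]+(\partial+\lambda)(v\circ u)+(-1)^{|u||v|}\lambda(u\circ v)+f_\lambda(u,v)\mathfrak{c},\qquad u,v\in\mathcal{A}\ \text{homogeneous},$$ where $f_\lambda$ is a 2-cocycle. Assume that $f_\lambda(u,v)=\sum_{i=0}^n\lambda^if_i(u,v)$ for $u,v\in\mathcal{A}$, with bilinear forms $f_i:\mathcal{A}\times\mathcal{A}\to\mathbb{C}$ and $f_n\neq0$. Then for all homogeneous $u,v,w\in\mathcal{A}$: (1) If $n>3$, then $f_n(u\circ v,\alpha(w))=0$. (2) If $n\le 3$, then (with $f_i=0$ for $i>n$) $$f_i(u,v)=(-1)^{|u||v|+i+1}f_i(v,u),\qquad i=0,\dots,3,$$ and $$(-1)^{|u||v|}f_3(u\circ v,\alpha(w))=f_3(\alpha(u),w\circ v)=f_3(v\circ u,\alpha(w)),$$ $$f_3([v,u],\alpha(w))+(-1)^{|u||v|}f_2(u\circ v,\alpha(w))=f_3(\alpha(u),[w,v])+f_2(\alpha(u),w\circ v),$$ $$3f_3([v,u],\alpha(w))-2f_2(v\circ u,\alpha(w))+(-1)^{|u||v|}f_2(u\circ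 v,\alpha(w))=-(-1)^{|u||v|}f_2(\alpha(v),w\circ u+(-1)^{|u||w|}u\circ w),$$ $$f_2([v,u],\alpha(w))+(-1)^{|u||v|}f_1(u\circ v,\alpha(w))=f_2(\alpha(u),[w,v])+f_1(\alpha(u),w\circ v),$$ $$f_1(\alpha(u),w\circ v+(-1)^{|v||w|}v\circ w)-(-1)^{|u||v|}f_1(\alpha(v),w\circ u+(-1)^{|u||w|}u\circ w)=2f_2([v,u],\alpha(w))-f_1(v\circ u,\alpha(w))+(-1)^{|u||v|}f_1(u\circ v,\alpha(w)),$$ $$f_1(\alpha(u),[w,v])+f_0(\alpha(u),w\circ v)-(-1)^{|u||v|}f_0(\alpha(v),w\circ u+(-1)^{|u||w|}u\circ w)=f_1([v,u],\alpha(w))+(-1)^{|u||v|}f_0(u\circ v,\alpha(w)),$$ $$f_0(\alpha(u),[w,v])-(-1)^{|u||v|}f_0(\alpha(v),[w,u])=f_0([v,u],\alpha(w)).$$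
   Context: All linear spaces and tensor products are over $\mathbb{C}$. A superspace is a $\mathbb{Z}_2$-graded linear space $\mathcal{A}=\mathcal{A}_0\oplus\mathcal{A}_1$; $|x|\in\{0,1\}$ is the parity of a homogeneous element $x$. Formulas containing $|x|$ are stated for homogeneous elements and extended by linearity. Hom-Lie superalgebra $(\mathcal{A},[\cdot,\cdot],\alpha)$: a superspace with an even bilinear map $[\cdot,\cdot]:\mathcal{A}\times\mathcal{A}\to\mathcal{A}$ and an even linear map $\alpha:\mathcal{A}\to\mathcal{A}$ such that for all homogeneous $x,y,z$: $[x,y]=-(-1)^{|x||y|}[y,x]$ and $(-1)^{|x||z|}[[x,y],\alpha(z)]+(-1)^{|x||y|}[[y,z],\alpha(x)]+(-1)^{|y||z|}[[z,x],\alpha(y)]=0$. Hom-Novikov superalgebra $(\mathcal{A},\circ,\alpha)$: a superspace with an even bilinear operation $\circ$ and an even linear map $\alpha$ such that for all homogeneous $x,y,z$: $(x\circ y)\circ\alpha(z)-\alpha(x)\circ(y\circ z)=(-1)^{|x||y|}\big((y\circ x)\circ\alpha(z)-\alpha(y)\circ(x\circ z)\big)$ and $(x\circ y)\circ\alpha(z)=(-1)^{|y||z|}(x\circ z)\circ\alpha(y)$. Super Hom-Gel'fand-Dorfman bialgebra $(\mathcal{A},[\cdot,\cdot],\circ,\alpha)$: a superspace with an even linear map $\alpha$ and two operations such that $(\mathcal{A},[\cdot,\cdot],\alpha)$ is a Hom-Lie superalgebra, $(\mathcal{A},\circ,\alpha)$ is a Hom-Novikov superalgebra, and for all homogeneous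 $x,y,z$: $[x\circ y,\alpha(z)]-(-1)^{|y||z|}[x\circ z,\alpha(y)]+[x,y]\circ\alpha(z)-(-1)^{|y||z|}[x,z]\circ\alpha(y)-\alpha(x)\circ[y,z]=0$. Hom-Lie conformal superalgebra $(\mathcal{R},[\cdot_\lambda\cdot],\alpha)$: a $\mathbb{Z}_2$-graded $\mathbb{C}[\partial]$-module with an even linear selfmap $\alpha$ satisfying $\alpha\partial=\partial\alpha$ and a $\mathbb{C}$-bilinear map $\mathcal{R}\otimes\mathcal{R}\to\mathbb{C}[\lambda]\otimes\mathcal{R}$, $a\otimes b\mapsto[a_\lambda b]$, such that for homogeneous $a,b,c$: $[\partial a_\lambda b]=-\lambda[a_\lambda b]$, $[a_\lambda\partial b]=(\partial+\lambda)[a_\lambda b]$; $[a_\lambda b]=-(-1)^{|a||b|}[b_{-\lambda-\partial}a]$; $[\alpha(a)_\lambda[b_\mu c]]=[[a_\lambda b]_{\lambda+\mu}\alpha(c)]+(-1)^{|a||b|}[\alpha(b)_\mu[a_\lambda c]]$. The quadratic Hom-Lie conformal superalgebra associated to $(\mathcal{A},[\cdot,\cdot],\circ,\alpha)$ is the free $\mathbb{C}[\partial]$-module $\mathcal{R}=\mathbb{C}[\partial]\mathcal{A}$ with $\alpha(f(\partial)u)=f(\partial)\alpha(u)$ and $[u_\lambda v]=[v,u]+(\partial+\lambda)(v\circ u)+(-1)^{|u||v|}\lambda(u\circ v)$ for homogeneous $u,v\in\mathcal{A}$, extended by $[f(\partial)u_\lambda h(\partial)v]=f(-\lambda)h(\partial+\lambda)[u_\lambda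 v]$. One-dimensional central extension: $\hat{\mathcal{R}}=\mathcal{R}\oplus\mathbb{C}\mathfrak{c}$ is a Hom-Lie conformal superalgebra with $\mathfrak{c}$ even, $\partial\mathfrak{c}=0$, $\mathfrak{c}$ having zero $\lambda$-bracket with everything, $\widehat{[a_\lambda b]}=[a_\lambda b]+f_\lambda(a,b)\mathfrak{c}$ for $a,b\in\mathcal{R}$, where $f_\lambda:\mathcal{R}\times\mathcal{R}\to\mathbb{C}[\lambda]$ is bilinear, and whose twisting map is compatible with $\alpha$ under the projection to $\mathcal{R}$ and preserves $\mathbb{C}\mathfrak{c}$. Then $f_\lambda$ is a 2-cocycle, meaning that for all homogeneous $a,b,c\in\mathcal{R}$: $f_\lambda(a,b)=-(-1)^{|a||b|}f_{-\lambda-\partial}(b,a)$ (which, since $\partial\mathfrak{c}=0$, reads $f_\lambda(a,b)=-(-1)^{|a||b|}f_{-\lambda}(b,a)$); $f_\lambda(\partial a,b)=-\lambda f_\lambda(a,b)=-f_\lambda(a,\partial b)$; $f_{\lambda+\mu}([a_\lambda b],\alpha(c))=f_\lambda(\alpha(a),[b_\mu c])-(-1)^{|a||b|}f_\mu(\alpha(b),[a_\lambda c])$. *)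

(* Defs.v *)
From HB Require Import structures.
From mathcomp Require Import all_boot all_algebra.
From mathcomp Require Import sesquilinear finmap.
From mathcomp.multinomials Require Import monalg.
From mathcomp Require Import boolp reals.
From mathcomp Require Import complex.

Set Implicit Arguments.
Unset Strict Implicit.
Unset Printing Implicit Defensive.

Import GRing.Theory.
Local Open Scope ring_scope.

Definition bilinear_map (K : fieldType) (U V W : lmodType K)
  (f : U -> V -> W) : Prop := bilinear_for *:%R *:%R f.

Definition bilinear_form (K : fieldType) (V : lmodType K)
  (f : V -> V -> K) : Prop := bilinear_for *%R *%R f.

(* vpoly V is K[X] (x) V, as finitely supported families of coefficients:
   q@_i is the coefficient of X^i and << v *g i >> is X^i (x) v.  It is used
   both for the free K[d]-module K[d]A (with X = d) and for K[lambda] (x) R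
   (with X = lambda). *)

Definition vpoly (K : fieldType) (V : lmodType K) : Type := {malg V[nat]}.

Section VPoly.
Variables (K : fieldType) (V : lmodType K).
Implicit Types (c : K) (q : vpoly V).

HB.instance Definition _ := GRing.Zmodule.on (vpoly V).

Definition vpoly_scale c q : vpoly V := [malg i in msupp q => c *: q@_i].

Lemma vpoly_scaleE c q i : (vpoly_scale c q)@_i = c *: q@_i.
Proof.
rewrite /vpoly_scale mcoeffE; case: ifP => // /negbT.
by rewrite -mcoeff_eq0 => /eqP ->; rewrite scaler0.
Qed.

Fact vpoly_scaleA a b q :
  vpoly_scale a (vpoly_scale b q) = vpoly_scale (a * b) q.
Proof. by apply/malgP => i; rewrite !vpoly_scaleE scalerA. Qed.

Fact vpoly_scale1 : left_id 1 vpoly_scale.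
Proof. by move=> q; apply/malgP => i; rewrite vpoly_scaleE scale1r. Qed.

Fact vpoly_scaleDr : right_distributive vpoly_scale +%R.
Proof.
by move=> c p q; apply/malgP => i; rewrite !(mcoeffD, vpoly_scaleE) scalerDr.
Qed.

Fact vpoly_scaleDl q : {morph vpoly_scale^~ q : a b / a + b}.
Proof.
by move=> a b; apply/malgP => i; rewrite !(mcoeffD, vpoly_scaleE) scalerDl.
Qed.

HB.instance Definition _ := GRing.Zmodule_isLmodule.Build K (vpoly V)
  vpoly_scaleA vpoly_scale1 vpoly_scaleDr vpoly_scaleDl.

Lemma vcoefZ c q i : (c *: q)@_i = c *: q@_i.
Proof. exact: vpoly_scaleE. Qed.

Definition vconst (v : V) : vpoly V := << v *g 0%N >>.

(* Substitution of the operator T for X, coefficients being read in W through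
   j:  sum_i T^i (j q_i). *)
Definition veval (W : zmodType) (T : W -> W) (j : V -> W) q : W :=
  \sum_(i <- msupp q) iter i T (j q@_i).

Lemma veval_const (W : zmodType) (T : W -> W) (j : V -> W) v :
  j 0 = 0 -> veval T j (vconst v) = j v.
Proof.
move=> j0; rewrite /veval /vconst msuppU; case: eqP => [->|_].
  by rewrite big_nil j0.
by rewrite big_seq_fset1 mcoeffU eqxx.
Qed.

Definition vshift q : vpoly V := \sum_(i <- msupp q) << q@_i *g i.+1 >>.

End VPoly.

Definition vmap (K : fieldType) (V W : lmodType K) (g : V -> W)
  (q : vpoly V) : vpoly W := \sum_(i <- msupp q) << g q@_i *g i >>.

(* (-1)^{|x||y|} for x of parity p and y of parity q *)
Notation koszul p q := ((-1) ^+ (p && q)).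

Record superspace (K : fieldType) := Superspace {
  ss_space :> lmodType K;
  homog : bool -> ss_space -> Prop;
  homog_subspace : forall p, homog p 0 /\
    forall (c : K) x y, homog p x -> homog p y -> homog p (c *: x + y);
  homog_decomp : forall x, exists x0 x1,
    [/\ homog false x0, homog true x1 & x = x0 + x1];
  homog_direct : forall x, homog false x -> homog true x -> x = 0 }.

Section Superspace.
Variables (K : fieldType) (V : superspace K).

Fact homog_decomp_pair (x : V) : exists y : V * V,
  [/\ homog false y.1, homog true y.2 & x = y.1 + y.2].
Proof. by have [x0 [x1 h]] := homog_decomp x; exists (x0, x1). Qed.

Definition hpart (p : bool) (x : V) : V :=
  let y := sval (cid (homog_decomp_pair x)) in if p then y.2 else y.1.

Lemma hpart_homog p x : homog p (hpart p x).
Proof. by rewrite /hpart; case: cid => y [] /=; case: p. Qed.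

Lemma hpartD x : x = hpart false x + hpart true x.
Proof. by rewrite /hpart; case: cid => y []. Qed.

Lemma homogB p (x y : V) : homog p x -> homog p y -> homog p (x - y).
Proof.
move=> hx hy; rewrite addrC -scaleN1r.
exact: (homog_subspace V p).2 hy hx.
Qed.

Lemma hpartE p q x : homog p x -> hpart q x = if p == q then x else 0.
Proof.
move=> hx; have [h0 _] := homog_subspace V p.
have {h0} step y : homog (~~ p) y -> homog p (x - y) -> y = 0.
  move=> hy hxy; have hy' : homog p y.
    by have := homogB hx hxy; rewrite opprB addrCA subrr addr0.
  by apply: homog_direct; case: (p) hy hy'.
have e : hpart (~~ p) x = 0.
  apply: step; first exact: hpart_homog.
  have -> : x - hpart (~~ p) x = hpart p x.
    by rewrite {1}(hpartD x); case: (p); rewrite /= ?addrK // addrAC subrr add0r.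
  exact: hpart_homog.
case: eqP => [<-|/eqP]; last by case: (p) (q) e => [] [].
by rewrite [RHS]hpartD; case: (p) e => /= ->; rewrite ?addr0 ?add0r.
Qed.

End Superspace.

Definition even_linear (K : fieldType) (V : superspace K) (g : V -> V) : Prop :=
  linear g /\ forall p x, homog p x -> homog p (g x).

Definition even_bilinear (K : fieldType) (V : superspace K)
    (m : V -> V -> V) : Prop :=
  bilinear_map m /\
  forall p q x y, homog p x -> homog q y -> homog (p (+) q) (m x y).

Section Bialgebra.
Variables (K : fieldType) (A : superspace K).
Implicit Types (lie nov : A -> A -> A) (alpha : A -> A).

Definition hom_lie_superalgebra lie alpha : Prop :=
  [/\ even_bilinear lie, even_linear alpha,
      forall p q (x y : A), homog p x -> homog q y ->
        lie x y = - (koszul p q *: lie y x)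
    & forall p q r (x y z : A), homog p x -> homog q y -> homog r z ->
        koszul p r *: lie (lie x y) (alpha z)
        + koszul p q *: lie (lie y z) (alpha x)
        + koszul q r *: lie (lie z x) (alpha y) = 0].

Definition hom_novikov_superalgebra nov alpha : Prop :=
  [/\ even_bilinear nov, even_linear alpha,
      forall p q r (x y z : A), homog p x -> homog q y -> homog r z ->
        nov (nov x y) (alpha z) - nov (alpha x) (nov y z)
        = koszul p q *:
            (nov (nov y x) (alpha z) - nov (alpha y) (nov x z))
    & forall p q r (x y z : A), homog p x -> homog q y -> homog r z ->
        nov (nov x y) (alpha z) = koszul q r *: nov (nov x z) (alpha y)].

Definition super_hom_gelfand_dorfman_bialgebra lie nov alpha : Prop :=
  [/\ hom_lie_superalgebra lie alpha, hom_novikov_superalgebra nov alpha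
    & forall p q r (x y z : A), homog p x -> homog q y -> homog r z ->
        lie (nov x y) (alpha z) - koszul q r *: lie (nov x z) (alpha y)
        + nov (lie x y) (alpha z) - koszul q r *: nov (lie x z) (alpha y)
        - nov (alpha x) (lie y z) = 0].

End Bialgebra.

(* A K[d]-module is given as a linear space with the operator d.  The
   lambda-bracket [a_lambda b] is br a b, an element of vpoly V. *)
Section Conformal.
Variables (K : fieldType) (V : superspace K).
Variables (d alpha : V -> V) (br : V -> V -> vpoly V).

(* K[lambda,mu] (x) V is vpoly (vpoly V), lambda being the inner variable and
   mu the outer one. *)
Definition mul_lambda : vpoly (vpoly V) -> vpoly (vpoly V) := vmap (@vshift K V).
Definition mul_mu : vpoly (vpoly V) -> vpoly (vpoly V) := @vshift K (vpoly V).
Definition const2 (v : V) : vpoly (vpoly V) := vconst (vconst v).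

(* q(-lambda-d), with the powers of d acting on the coefficients of q *)
Definition subst_skew (q : vpoly V) : vpoly V :=
  veval (fun w => - vshift w - vmap d w) (@vconst K V) q.

Definition hom_lie_conformal_superalgebra : Prop :=
  [/\ [/\ even_linear d, even_linear alpha, forall a, alpha (d a) = d (alpha a)
        & bilinear_map br],
      (forall a b, br (d a) b = - vshift (br a b)) /\
      (forall a b, br a (d b) = vmap d (br a b) + vshift (br a b)),
      forall p q a b, homog p a -> homog q b ->
        br a b = - (koszul p q *: subst_skew (br b a))
    & forall p q r a b c, homog p a -> homog q b -> homog r c ->
        veval mul_mu
          (fun x => veval mul_lambda const2 (br (alpha a) x)) (br b c)
        = veval mul_lambda
            (fun x => veval (fun w => mul_lambda w + mul_mu w) const2
                        (br x (alpha c))) (br a b)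
          + koszul p q *:
            veval mul_lambda
              (fun x => veval mul_mu const2 (br (alpha b) x)) (br a c)].

(* f_T(a,b) in K[lambda,mu] = {poly {poly K}}, for T in K[lambda,mu]; here
   too lambda = 'X%:P is the inner variable and mu = 'X the outer one. *)
Definition form_at (f : V -> V -> {poly K}) (T : {poly {poly K}}) (a b : V) :
  {poly {poly K}} := (map_poly (polyC \o polyC) (f a b)).[T].

Definition two_cocycle (f : V -> V -> {poly K}) : Prop :=
  let lambda : {poly {poly K}} := 'X%:P in
  let mu : {poly {poly K}} := 'X in
  [/\ bilinear_map f,
      forall p q a b, homog p a -> homog q b ->
        f a b = - (koszul p q *: (f b a \Po (- 'X))),
      (forall a b, f (d a) b = - ('X * f a b)) /\
      (forall a b, - ('X * f a b) = - f a (d b))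
    & forall p q r a b c, homog p a -> homog q b -> homog r c ->
        veval ( *%R lambda)
          (fun x => form_at f (lambda + mu) x (alpha c)) (br a b)
        = veval ( *%R mu) (fun x => form_at f lambda (alpha a) x) (br b c)
          - koszul p q *
            veval ( *%R lambda) (fun x => form_at f mu (alpha b) x) (br a c)].

End Conformal.

Section Extension.
Variables (K : fieldType) (V : superspace K).

(* V (+) K c, with c = (0, 1) even *)
Definition ext_homog (p : bool) (x : (V * K^o)%type) : Prop :=
  homog p x.1 /\ (p -> x.2 = 0).

Fact ext_homog_subspace p : ext_homog p 0 /\
  forall (c : K) x y, ext_homog p x -> ext_homog p y -> ext_homog p (c *: x + y).
Proof.
have [h0 hl] := homog_subspace V p; split=> [//|c x y [x1 x2] [y1 y2]].
split; first exact: hl.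
by move=> hp /=; rewrite (x2 hp) (y2 hp) scaler0 addr0.
Qed.

Fact ext_homog_decomp x : exists x0 x1,
  [/\ ext_homog false x0, ext_homog true x1 & x = x0 + x1].
Proof.
case: x => v t; have [v0 [v1 [h0 h1 ->]]] := homog_decomp v.
by exists (v0, t), (v1, 0); split=> //; congr pair; rewrite /= addr0.
Qed.

Fact ext_homog_direct x : ext_homog false x -> ext_homog true x -> x = 0.
Proof.
case: x => v t [/= h0 _] [/= h1 /(_ isT) /= ->].
by rewrite (homog_direct h0 h1).
Qed.

Definition ext_space : superspace K :=
  Superspace ext_homog_subspace ext_homog_decomp ext_homog_direct.

(* The data (ext_space, (d,0), alphah, brh) is a one-dimensional central
   extension of (V, d, alpha, br), with bracket [a_lambda b] + f(a,b) c. *)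
Definition central_extension (d alpha : V -> V) (br : V -> V -> vpoly V)
    (alphah : ext_space -> ext_space)
    (brh : ext_space -> ext_space -> vpoly ext_space)
    (f : V -> V -> {poly K}) : Prop :=
  [/\ hom_lie_conformal_superalgebra
        (fun x : ext_space => (d x.1, 0) : ext_space) alphah brh,
      (forall x : ext_space, (alphah x).1 = alpha x.1) /\
      (forall t : K, (alphah (0, t)).1 = 0),
      forall (t : K) (x : ext_space), brh (0, t) x = 0 /\ brh x (0, t) = 0,
      bilinear_map f
    & forall (a b : V) i,
        (brh (a, 0) (b, 0))@_i = ((br a b)@_i, (f a b)`_i)].

End Extension.

Section Quadratic.
Variables (K : fieldType) (A : superspace K).

Definition free_homog (p : bool) (q : vpoly A) : Prop :=
  forall i, homog p q@_i.

Fact free_homog_subspace p : free_homog p 0 /\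
  forall (c : K) x y, free_homog p x -> free_homog p y ->
    free_homog p (c *: x + y).
Proof.
have [h0 hl] := homog_subspace A p; split=> [i|c x y hx hy i].
  by rewrite mcoeff0.
by rewrite mcoeffD vcoefZ; apply: hl.
Qed.

Fact free_homog_decomp x : exists x0 x1,
  [/\ free_homog false x0, free_homog true x1 & x = x0 + x1].
Proof.
pose part p : vpoly A := [malg i in msupp x => hpart p x@_i].
have partE p i : (part p)@_i = hpart p x@_i.
  rewrite mcoeffE; case: ifP => // /negbT; rewrite -mcoeff_eq0 => /eqP ->.
  by rewrite (hpartE _ (homog_subspace A p).1) eqxx.
exists (part false), (part true); split.
- by move=> i; rewrite partE; apply: hpart_homog.
- by move=> i; rewrite partE; apply: hpart_homog.
by apply/malgP => i; rewrite mcoeffD !partE -hpartD.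
Qed.

Fact free_homog_direct x : free_homog false x -> free_homog true x -> x = 0.
Proof.
by move=> h0 h1; apply/malgP => i; rewrite mcoeff0; apply: homog_direct.
Qed.

(* the free K[d]-module K[d]A; A sits in it through vconst *)
Definition free_space : superspace K :=
  Superspace free_homog_subspace free_homog_decomp free_homog_direct.

Definition free_d : free_space -> free_space := @vshift K A.
Definition free_alpha (alpha : A -> A) : free_space -> free_space := vmap alpha.

Variables (lie nov : A -> A -> A).

(* the bilinear extension of (-1)^{|u||v|} u o v *)
Definition signed_nov (u v : A) : A :=
  \sum_(p : bool) \sum_(q : bool) koszul p q *: nov (hpart p u) (hpart q v).

(* [u_lambda v] for u, v in A *)
Definition quad_bracket0 (u v : A) : vpoly free_space :=
  const2 (lie v u)
  + (vmap free_d (const2 (nov v u)) + vshift (const2 (nov v u)))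
  + vshift (const2 (signed_nov u v)).

(* [f(d)u_lambda h(d)v] = f(-lambda) h(d+lambda) [u_lambda v] *)
Definition quad_bracket (a b : free_space) : vpoly free_space :=
  veval (fun w => - vshift w)
    (fun u => veval (fun w => vmap free_d w + vshift w) (quad_bracket0 u) b) a.

Section BracketOnA.
Hypotheses (lieB : bilinear_map lie) (novB : bilinear_map nov).

Fact bilin0l (m : A -> A -> A) y : bilinear_map m -> m 0 y = 0.
Proof.
by move=> mB; have := mB.1 y (-1) 0 0; rewrite scaler0 addr0 /= scaleN1r addNr.
Qed.

Fact bilin0r (m : A -> A -> A) y : bilinear_map m -> m y 0 = 0.
Proof.
by move=> mB; have := mB.2 y (-1) 0 0; rewrite scaler0 addr0 /= scaleN1r addNr.
Qed.

Fact hpart0 p : hpart p (0 : A) = 0.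
Proof. by rewrite (hpartE _ (homog_subspace A p).1) eqxx. Qed.

Lemma signed_novE p q (u v : A) :
  homog p u -> homog q v -> signed_nov u v = koszul p q *: nov u v.
Proof.
move=> hu hv; rewrite /signed_nov !big_bool !(hpartE _ hu) !(hpartE _ hv).
by case: (p) (q) => [] [];
  rewrite /= !(bilin0l _ novB, bilin0r _ novB, scaler0, addr0, add0r).
Qed.

Fact quad_bracket0_0 u v : u = 0 \/ v = 0 -> quad_bracket0 u v = 0.
Proof.
move=> uv0; rewrite /quad_bracket0.
have -> : lie v u = 0 by case: uv0 => ->; rewrite ?bilin0l ?bilin0r.
have -> : nov v u = 0 by case: uv0 => ->; rewrite ?bilin0l ?bilin0r.
have -> : signed_nov u v = 0.
  rewrite /signed_nov big1 // => p _; rewrite big1 // => q _.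
  by case: uv0 => ->; rewrite hpart0 ?bilin0l ?bilin0r ?scaler0.
have -> : const2 (0 : A) = 0 by rewrite /const2 /vconst !raddf0.
by rewrite /vmap /vshift msupp0 !big_nil !addr0.
Qed.

Lemma quad_bracketE p q (u v : A) : homog p u -> homog q v ->
  quad_bracket (vconst u) (vconst v) =
    const2 (lie v u)
    + (vmap free_d (const2 (nov v u)) + vshift (const2 (nov v u)))
    + vshift (const2 (koszul p q *: nov u v)).
Proof.
move=> hu hv; rewrite /quad_bracket veval_const.
  rewrite veval_const; last by apply: quad_bracket0_0; right.
  by rewrite /quad_bracket0 (signed_novE hu hv).
rewrite veval_const; last by apply: quad_bracket0_0; right.
by apply: quad_bracket0_0; left.
Qed.

End BracketOnA.

End Quadratic.

(* Main.v *)
(** Taken at elements of [A], the cocycle condition is an identity between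
   polynomials in lambda and mu, because
   [f_(lambda+mu) (d a, b) = - (lambda + mu) f_(lambda+mu) (a, b)] and
   [f_lambda (a, d b) = lambda f_lambda (a, b)] eliminate [d].  Comparing the
   coefficients of [lambda^a mu^b] gives all relations of (2) at total degree
   at most 4; when [n > 3], degree [n + 1] contains two independent equations
   in [f_n (u o v, alpha w)] and [f_n (v o u, alpha w)] alone. *)

Require Import Defs.
From mathcomp Require Import all_boot all_algebra.
From mathcomp.multinomials Require Import monalg.
From mathcomp Require Import reals complex.
From mathcomp Require Import finmap ring.

Set Implicit Arguments.
Unset Strict Implicit.
Unset Printing Implicit Defensive.

Import GRing.Theory.
Local Open Scope ring_scope.

(** * Substituting an additive operator into a vector-valued polynomial *)

Section VevalTheory.
Variables (K : fieldType) (V : lmodType K).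

Lemma vshift_const (v : V) : vshift (vconst v) = << v *g 1%N >>.
Proof.
rewrite /vshift /vconst msuppU; case: eqP => [->|_].
  by rewrite big_nil raddf0.
by rewrite big_seq_fset1 mcoeffU eqxx.
Qed.

Lemma vmap_const (W : lmodType K) (g : V -> W) (v : V) :
  g 0 = 0 -> vmap g (vconst v) = vconst (g v).
Proof.
move=> g0; rewrite /vmap /vconst msuppU; case: eqP => [->|_].
  by rewrite big_nil g0 raddf0.
by rewrite big_seq_fset1 mcoeffU eqxx.
Qed.

Variables (W : zmodType) (T : W -> W) (j : V -> W).
Hypotheses (TD : {morph T : x y / x + y}) (jD : {morph j : x y / x + y}).

Let T0 : T 0 = 0.
Proof. by apply: (@addIr _ (T 0)); rewrite -TD !add0r. Qed.

Let j0 : j 0 = 0.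
Proof. by apply: (@addIr _ (j 0)); rewrite -jD !add0r. Qed.

Let iterT0 i : iter i T 0 = 0.
Proof. by elim: i => //= i ->. Qed.

Let iterTD i : {morph iter i T : x y / x + y}.
Proof. by elim: i => [|i IH] x y //; rewrite !iterS IH TD. Qed.

(** Allows sums over different supports to be compared on a common finite set: a zero coefficient
    contributes nothing, since additive maps kill 0. *)
Lemma veval_widen (q : vpoly V) (d : {fset nat}) :
  (msupp q `<=` d)%fset -> veval T j q = \sum_(i <- d) iter i T (j q@_i).
Proof.
move=> sqd; apply: big_fset_incl => // i _.
by rewrite -mcoeff_eq0 => /eqP->; rewrite j0 iterT0.
Qed.

Lemma vevalD : {morph veval T j : p q / p + q}.
Proof.
move=> p q; pose d := (msupp p `|` msupp q)%fset.
rewrite (@veval_widen p d) ?fsubsetUl// (@veval_widen q d) ?fsubsetUr//.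
rewrite (@veval_widen (p + q) d) ?msuppD_le// -big_split /=.
by apply: eq_bigr => i _; rewrite mcoeffD jD iterTD.
Qed.

Lemma veval_monomial v i : veval T j << v *g i >> = iter i T (j v).
Proof.
rewrite /veval msuppU; case: eqP => [->|_].
  by rewrite big_nil j0 iterT0.
by rewrite big_seq_fset1 mcoeffU eqxx.
Qed.

End VevalTheory.

Lemma vconst_homog (K : fieldType) (A : superspace K) p (x : A) :
  homog p x -> @homog _ (free_space A) p (vconst x).
Proof.
move=> hx i; rewrite mcoeffU; case: eqP => _ //.
by rewrite mulr0n; exact: (homog_subspace A p).1.
Qed.

(** The bracket of two elements of [A] has degree at most one in lambda and in d, so only four terms
    remain. In the cocycle identity [T] is multiplication by lambda or mu, and [j] is the form with
    one slot fixed. *)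
Lemma veval_quad_bracket (K : fieldType) (A : superspace K)
    (lie nov : A -> A -> A) (W : zmodType) (T : W -> W)
    (j : free_space A -> W) p q (u v : A) :
  bilinear_map lie -> bilinear_map nov ->
  {morph T : x y / x + y} -> {morph j : x y / x + y} ->
  homog p u -> homog q v ->
  veval T j (quad_bracket lie nov (vconst u) (vconst v)) =
    j (vconst (lie v u)) + j (free_d (vconst (nov v u)))
    + T (j (vconst (nov v u))) + T (j (vconst (koszul p q *: nov u v))).
Proof.
move=> lieB novB TD jD hu hv.
have d0 : free_d (0 : free_space A) = 0.
  by rewrite /free_d /vshift msupp0 big_nil.
rewrite (quad_bracketE lieB novB hu hv) /const2 !vshift_const vmap_const//.
by rewrite !vevalD// !veval_monomial //= !addrA.
Qed.

(** * Additivity and sesquilinearity of the form at a bivariate polynomial *)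

Section FormAt.
Variables (K : fieldType) (V : superspace K) (f : V -> V -> {poly K}).
Implicit Types (T : {poly {poly K}}) (a b : V).

Lemma form_atDl T b : bilinear_map f ->
  {morph (fun a => form_at f T a b) : x y / x + y}.
Proof.
move=> fB x y; rewrite /form_at.
by have /= := fB.1 b 1 x y; rewrite !scale1r => ->; rewrite rmorphD hornerD.
Qed.

Lemma form_atDr T a : bilinear_map f -> {morph form_at f T a : x y / x + y}.
Proof.
move=> fB x y; rewrite /form_at.
by have /= := fB.2 a 1 x y; rewrite !scale1r => ->; rewrite rmorphD hornerD.
Qed.

Lemma form_at_dl (d : V -> V) T a b : f (d a) b = - ('X * f a b) ->
  form_at f T (d a) b = - (T * form_at f T a b).
Proof.
by rewrite /form_at => ->; rewrite rmorphN rmorphM /= map_polyX !hornerE.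
Qed.

Lemma form_at_dr (d : V -> V) T a b : - ('X * f a b) = - f a (d b) ->
  form_at f T a (d b) = T * form_at f T a b.
Proof.
by rewrite /form_at => /oppr_inj <-; rewrite rmorphM /= map_polyX !hornerE.
Qed.

End FormAt.

(** * Coefficients in lambda and mu: the outer index [b] is the exponent of mu, the inner index [a]
    that of lambda *)

Section BivariateCoefficients.
Variable K : fieldType.
Local Notation lambda := ('X%:P : {poly {poly K}}).
Local Notation mu := ('X : {poly {poly K}}).
Implicit Types (P : {poly {poly K}}) (c : K).

Lemma coef_comp_polyNX (p : {poly K}) i : (p \Po - 'X)`_i = (-1) ^+ i * p`_i.
Proof.
elim/poly_ind: p i => [|p c IH] i; first by rewrite comp_poly0 !coef0 mulr0.
rewrite comp_poly_MXaddC mulrN !coefD coefN !coefMX !coefC.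
by case: i => [|i] /=; rewrite ?expr0 ?mul1r ?oppr0 ?addr0 ?IH ?exprS; ring.
Qed.

Lemma coef2_lambdaM P a b :
  (lambda * P)`_b`_a = if a is a'.+1 then P`_b`_a' else 0.
Proof. by rewrite coefCM coefXM; case: a. Qed.

Lemma coef2_muM P a b : (mu * P)`_b`_a = if b is b'.+1 then P`_b'`_a else 0.
Proof. by rewrite coefXM; case: b => //=; rewrite coef0. Qed.

Lemma coef2_lambdaX c i a b :
  (c%:P%:P * lambda ^+ i)`_b`_a = if (b == 0%N) && (a == i) then c else 0.
Proof.
rewrite -polyC_exp -polyCM coefC; case: b => [|b] /=; last by rewrite coef0.
by rewrite coefCM coefXn; case: eqP => _; rewrite ?mulr1 ?mulr0.
Qed.

Lemma coef2_muX c i a b :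
  (c%:P%:P * mu ^+ i)`_b`_a = if (a == 0%N) && (b == i) then c else 0.
Proof.
rewrite coefCM coefXn; case: (b == i); rewrite ?mulr1 ?mulr0 ?andbT ?andbF.
  by rewrite coefC.
by rewrite coef0.
Qed.

(** Binomial theorem: only the summand [k = b] can contribute, and it does so exactly when
    [a = i - b]. *)
Lemma coef2_lambda_muX c i a b :
  (c%:P%:P * (lambda + mu) ^+ i)`_b`_a =
  if (a + b == i)%N then c * 'C(a + b, b)%:R else 0.
Proof.
rewrite coefCM coefCM exprDn coef_sum coef_sum.
have E (k : 'I_i.+1) :
    (lambda ^+ (i - k) * mu ^+ k *+ 'C(i, k))`_b`_a =
    if (b == k) && (a == i - k)%N then 'C(i, k)%:R else 0.
  rewrite coefMn coefMn -polyC_exp coefCM !coefXn.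
  case: (b == k); rewrite ?mulr1 ?mulr0 ?coef0 ?mul0rn //= coefXn.
  by case: eqP => _; rewrite ?mul0rn.
rewrite (eq_bigr _ (fun k _ => E k)) -big_mkcond /=.
case: eqP => [<-|abi].
  have lb : (b < (a + b).+1)%N by rewrite ltnS leq_addl.
  rewrite (big_pred1 (Ordinal lb)) // => k /=.
  rewrite -val_eqE /= eq_sym; case: eqP => //= ->.
  by rewrite addnK eqxx.
rewrite big_pred0 ?mulr0 // => k; apply/negP => /andP[/eqP bk /eqP ak].
by apply: abi; rewrite ak bk subnK// -ltnS.
Qed.

End BivariateCoefficients.

(** * Coefficients of the form at lambda, mu and lambda + mu *)

Section FormCoefficients.
Variables (K : fieldType) (V : superspace K) (f : V -> V -> {poly K}).
Variables (n : nat) (x y : V) (c : nat -> K).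
Hypotheses (fE : f x y = \sum_(i < n.+1) c i *: 'X^i)
  (c0 : forall i, (n < i)%N -> c i = 0).
Local Notation lambda := ('X%:P : {poly {poly K}}).
Local Notation mu := ('X : {poly {poly K}}).

Lemma form_atE T : form_at f T x y = \sum_(i < n.+1) (c i)%:P%:P * T ^+ i.
Proof.
rewrite /form_at fE rmorph_sum horner_sum; apply: eq_bigr => i _.
by rewrite -mul_polyC rmorphM /= map_polyC map_polyXn !hornerE.
Qed.

(** Since [g] vanishes past [n], no bound on [i] is required, and the coefficient formulas below
    hold for all exponents. *)
Let sum_pick (i : nat) (g : nat -> K) : (forall k, (n < k)%N -> g k = 0) ->
  \sum_(k < n.+1) (if i == k then g k else 0) = g i.
Proof.
move=> g0; rewrite -big_mkcond /=; case: (ltnP i n.+1) => [lin|ni].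
  by rewrite (big_pred1 (Ordinal lin)) // => k; rewrite -val_eqE /= eq_sym.
rewrite g0// big_pred0 // => k; apply/negP => /eqP ik.
by have := ltn_ord k; rewrite -ik ltnNge ni.
Qed.

Lemma form_at_lambda_coef a b :
  (form_at f lambda x y)`_b`_a = if b is 0 then c a else 0.
Proof.
rewrite form_atE !coef_sum; under eq_bigr do rewrite coef2_lambdaX.
by case: b => [|b] /=; [exact: sum_pick | rewrite big1].
Qed.

Lemma form_at_mu_coef a b :
  (form_at f mu x y)`_b`_a = if a is 0 then c b else 0.
Proof.
rewrite form_atE !coef_sum; under eq_bigr do rewrite coef2_muX.
by case: a => [|a] /=; [exact: sum_pick | rewrite big1].
Qed.

Lemma form_at_lambda_mu_coef a b :
  (form_at f (lambda + mu) x y)`_b`_a = c (a + b)%N * 'C(a + b, b)%:R.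
Proof.
rewrite form_atE !coef_sum; under eq_bigr do rewrite coef2_lambda_muX.
by rewrite (sum_pick _ (g := fun k => c k * _))// => k /c0 ->; rewrite mul0r.
Qed.

End FormCoefficients.

(** * The 2-cocycle conditions on [A], read coefficientwise *)

Section CocycleCoefficients.
Variables (K : fieldType) (A : superspace K).
Variables (lie nov : A -> A -> A) (alpha : A -> A).
Variables (f : free_space A -> free_space A -> {poly K}).
Variables (n : nat) (fi : nat -> A -> A -> K).
Hypotheses (lieB : bilinear_map lie) (novB : bilinear_map nov).
Hypothesis alphaL : linear alpha.
Hypothesis hf :
  two_cocycle (@free_d _ A) (free_alpha alpha) (quad_bracket lie nov) f.
Hypothesis hfi : forall i, bilinear_form (fi i).
Hypothesis hfE : forall u v : A,
  f (vconst u) (vconst v) = \sum_(i < n.+1) fi i u v *: 'X^i.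
Hypothesis hfi0 : forall i, (n < i)%N -> forall u v : A, fi i u v = 0.
Local Notation lambda := ('X%:P : {poly {poly K}}).
Local Notation mu := ('X : {poly {poly K}}).

Lemma fi_scalel i c u v : fi i (c *: u) v = c * fi i u v.
Proof.
have fi0 : fi i 0 v = 0.
  by have /= := (hfi i).1 v (-1) 0 0; rewrite scaler0 addr0 mulN1r addNr.
by have /= := (hfi i).1 v c u 0; rewrite !addr0 fi0 addr0.
Qed.

Lemma fi_scaler i c u v : fi i u (c *: v) = c * fi i u v.
Proof.
have fi0 : fi i u 0 = 0.
  by have /= := (hfi i).2 u (-1) 0 0; rewrite scaler0 addr0 mulN1r addNr.
by have /= := (hfi i).2 u c v 0; rewrite !addr0 fi0 addr0.
Qed.

Lemma fi_addr i u v w : fi i u (v + w) = fi i u v + fi i u w.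
Proof. by have /= := (hfi i).2 u 1 v w; rewrite scale1r mul1r. Qed.

Let f_coef u v i : (f (vconst u) (vconst v))`_i = fi i u v.
Proof.
rewrite hfE coef_sum; case: (ltnP i n.+1) => [lin|ni].
  rewrite (bigD1 (Ordinal lin))//= coefZ coefXn eqxx mulr1 big1 ?addr0// => k.
  by rewrite -val_eqE /= coefZ coefXn eq_sym => /negbTE ->; rewrite mulr0.
rewrite hfi0// big1// => k _; rewrite coefZ coefXn.
case: eqP => [ik|_]; last by rewrite mulr0.
by have := ltn_ord k; rewrite -ik ltnNge ni.
Qed.

(** The exponent collects the Koszul sign, the sign of lambda^i under lambda -> -lambda, and the
    leading minus sign of skew-symmetry. *)
Lemma fi_skew p q u v i : homog p u -> homog q v ->
  fi i u v = (-1) ^+ ((p && q) + i + 1)%N * fi i v u.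
Proof.
move=> hu hv; have [_ fskew _ _] := hf.
rewrite -!f_coef (fskew _ _ _ _ (vconst_homog hu) (vconst_homog hv)).
by rewrite coefN coefZ coef_comp_polyNX !exprD expr1; ring.
Qed.

(** This is the coefficient of lambda^a mu^b. On the left d acts as -(lambda + mu), so (d +
    lambda)(v o u) leaves only -mu (v o u). On the right d acts as lambda in the first term and as
    mu in the second, so both get the factor lambda + mu on w o v and w o u; one half joins the
    Koszul-signed product. *)
Lemma cocycle_coef p q r (u v w : A) a b :
  homog p u -> homog q v -> homog r w ->
  fi (a + b)%N (lie v u) (alpha w) * 'C(a + b, b)%:R
  - (if b is b'.+1 then
       fi (a + b')%N (nov v u) (alpha w) * 'C(a + b', b')%:R else 0)
  + (if a is a'.+1 then
       koszul p q * fi (a' + b)%N (nov u v) (alpha w) * 'C(a' + b, b)%:R else 0)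
  = (if b is 0 then fi a (alpha u) (lie w v) else 0)
    + (if (a, b) is (a'.+1, 0) then fi a' (alpha u) (nov w v) else 0)
    + (if b is 1 then
         fi a (alpha u) (nov w v + koszul q r *: nov v w) else 0)
    - koszul p q *
      ((if a is 0 then fi b (alpha v) (lie w u) else 0)
       + (if (a, b) is (0, b'.+1) then fi b' (alpha v) (nov w u) else 0)
       + (if a is 1 then
            fi b (alpha v) (nov w u + koszul p r *: nov u w) else 0)).
Proof.
move=> hu hv hw; have [fB _ [fdl fdr] fJ] := hf.
have alpha0 : alpha 0 = 0.
  by have := alphaL (-1) 0 0; rewrite scaler0 addr0 scaleN1r addNr.
have D (c : {poly {poly K}}) : {morph *%R c : x y / x + y} by exact: mulrDr.
have := fJ _ _ _ _ _ _ (vconst_homog hu) (vconst_homog hv)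
  (vconst_homog hw).
rewrite /free_alpha !vmap_const//.
rewrite (veval_quad_bracket lieB novB (D _) _ hu hv); last exact: form_atDl.
rewrite (veval_quad_bracket lieB novB (D _) _ hv hw); last exact: form_atDr.
rewrite (veval_quad_bracket lieB novB (D _) _ hu hw); last exact: form_atDr.
rewrite !(form_at_dl _ (fdl _ _)) !(form_at_dr _ (fdr _ _)) => E.
have sgnE (s : bool) P : (((-1) ^+ s : {poly {poly K}}) * P)`_b`_a =
    (-1) ^+ s * P`_b`_a.
  by case: s; rewrite ?expr1 ?expr0 ?mul1r // !mulN1r !coefN.
have fi0 x y i : (n < i)%N -> fi i x y = 0 by move=> /hfi0.
have := congr1 (fun P : {poly {poly K}} => P`_b`_a) E.
rewrite !(mulrDl, coefD, coefN, sgnE, coef2_lambdaM, coef2_muM).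
have FsE x y := form_at_lambda_mu_coef (f := f) (hfE x y) (fi0 x y).
have FlE x y := form_at_lambda_coef (f := f) (hfE x y) (fi0 x y).
have FmE x y := form_at_mu_coef (f := f) (hfE x y) (fi0 x y).
(* Generalizing the three evaluations keeps unification from comparing
   ['X%:P + 'X], ['X%:P] and ['X] up to conversion. *)
move: (form_at f (lambda + mu)) FsE (form_at f lambda) FlE (form_at f mu) FmE.
move=> Fs FsE Fl FlE Fm FmE.
(* The formula distinguishes only the exponents 0, 1 and at least 2, so nine cases resolve every
   [match]. *)
case: a {E sgnE} => [|[|a]]; case: b => [|[|b]]; cbv beta iota;
  rewrite !(FsE, FlE, FmE); cbv beta iota;
  rewrite ?fi_scalel ?fi_addr ?fi_scaler => E.
(* With goal and [E] both in the form [_ = 0], they differ by a ring identity. *)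
all: apply: subr0_eq; move/eqP: E; rewrite -subr_eq0 => /eqP E.
all: by rewrite -[RHS]E; ring.
Qed.

End CocycleCoefficients.

Theorem theorem5p2 (R : realType) (A : superspace R[i])
  (lie nov : A -> A -> A) (alpha : A -> A)
  (alphah : ext_space (free_space A) -> ext_space (free_space A))
  (brh : ext_space (free_space A) -> ext_space (free_space A) ->
         vpoly (ext_space (free_space A)))
  (f : free_space A -> free_space A -> {poly R[i]})
  (n : nat) (fi : nat -> A -> A -> R[i])
  (hA : super_hom_gelfand_dorfman_bialgebra lie nov alpha)
  (hext : central_extension (@free_d _ A) (free_alpha alpha)
            (quad_bracket lie nov) alphah brh f)
  (hf : two_cocycle (@free_d _ A) (free_alpha alpha) (quad_bracket lie nov) f)
  (hfi : forall i, bilinear_form (fi i))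
  (hfE : forall u v : A,
     f (vconst u) (vconst v) = \sum_(i < n.+1) fi i u v *: 'X^i)
  (hfn : exists u v : A, fi n u v <> 0)
  (hfi0 : forall i, (n < i)%N -> forall u v : A, fi i u v = 0) :
  ((3 < n)%N ->
     forall p q r (u v w : A), homog p u -> homog q v -> homog r w ->
       fi n (nov u v) (alpha w) = 0)
  /\
  ((n <= 3)%N ->
     forall p q r (u v w : A), homog p u -> homog q v -> homog r w ->
     (forall i, (i <= 3)%N ->
        fi i u v = (-1) ^+ ((p && q) + i + 1)%N * fi i v u)
     /\ (koszul p q * fi 3%N (nov u v) (alpha w) = fi 3%N (alpha u) (nov w v)
         /\ fi 3%N (alpha u) (nov w v) = fi 3%N (nov v u) (alpha w))
     /\ fi 3%N (lie v u) (alpha w) + koszul p q * fi 2%N (nov u v) (alpha w)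
        = fi 3%N (alpha u) (lie w v) + fi 2%N (alpha u) (nov w v)
     /\ 3%:R * fi 3%N (lie v u) (alpha w) - 2%:R * fi 2%N (nov v u) (alpha w)
        + koszul p q * fi 2%N (nov u v) (alpha w)
        = - (koszul p q * fi 2%N (alpha v) (nov w u + koszul p r *: nov u w))
     /\ fi 2%N (lie v u) (alpha w) + koszul p q * fi 1%N (nov u v) (alpha w)
        = fi 2%N (alpha u) (lie w v) + fi 1%N (alpha u) (nov w v)
     /\ fi 1%N (alpha u) (nov w v + koszul q r *: nov v w)
        - koszul p q * fi 1%N (alpha v) (nov w u + koszul p r *: nov u w)
        = 2%:R * fi 2%N (lie v u) (alpha w) - fi 1%N (nov v u) (alpha w)
          + koszul p q * fi 1%N (nov u v) (alpha w)
     /\ fi 1%N (alpha u) (lie w v) + fi 0%N (alpha u) (nov w v)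
        - koszul p q * fi 0%N (alpha v) (nov w u + koszul p r *: nov u w)
        = fi 1%N (lie v u) (alpha w) + koszul p q * fi 0%N (nov u v) (alpha w)
     /\ fi 0%N (alpha u) (lie w v) - koszul p q * fi 0%N (alpha v) (lie w u)
        = fi 0%N (lie v u) (alpha w)).
Proof.
have [[[lieB _] [alphaL _] _ _] [[novB _] _ _ _] _] := hA.
have C := cocycle_coef lieB novB alphaL hf hfi hfE hfi0.
split=> [n3 p q r u v w hu hv hw | n3 p q r u v w hu hv hw].
  case: n n3 C hfi0 {hfE hfn} => [|[|[|[|m]]]] // _ C fi0.
  (* The coefficients of lambda^2 mu^(n-1) and lambda^3 mu^(n-2) are two
     linear equations in f_n(v o u, alpha w) and f_n(u o v, alpha w), of
     determinant C(n,2)^2 - n C(n,3) = n^2 (n-1) (n+1) / 12. *)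
  have := C _ _ _ _ _ _ 2%N m.+3 hu hv hw.
  have := C _ _ _ _ _ _ 3%N m.+2 hu hv hw.
  rewrite !(addSn, add0n) !(fi0 m.+4.+1)// !(mul0r, mulr0, addr0, subr0, add0r).
  have -> : 'C(m.+4, m.+1) = 'C(m.+4, 3) by exact: (@bin_sub m.+4 3).
  have -> : 'C(m.+4, m.+2) = 'C(m.+4, 2) by exact: (@bin_sub m.+4 2).
  have -> : 'C(m.+4, m.+3) = m.+4 by rewrite binSn.
  (* Clearing the denominators 2 and 6 lets [ring] treat the binomials as atoms. *)
  have c2 : 2%:R * 'C(m.+4, 2)%:R = m.+4%:R * m.+3%:R :> R[i].
    by rewrite -!natrM -(mul_bin_diag m.+4 1) bin1.
  have c3 : 6%:R * 'C(m.+4, 3)%:R = m.+4%:R * m.+3%:R * m.+2%:R :> R[i].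
    rewrite -!natrM (_ : 6 = 2 * 3)%N// -mulnA -(mul_bin_diag m.+4 2) mulnCA.
    by rewrite -(mul_bin_diag m.+3 1) bin1 mulnA.
  set N := fi _ (nov v u) _; set M := koszul p q * _ => e1 e2.
  move: e1 e2; rewrite oppr0 !(addrC (- _)) => /subr0_eq e1 /subr0_eq e2.
  have : M * (m.+4%:R ^+ 2 * m.+3%:R * m.+4.+1%:R) = 0.
    have D : m.+4%:R ^+ 2 * m.+3%:R * m.+4.+1%:R =
        12%:R * ('C(m.+4, 2)%:R ^+ 2 - m.+4%:R * 'C(m.+4, 3)%:R) :> R[i].
      (* Twelve is distributed so that [c2] and [c3] apply: 3 (2x)^2 = 12 x^2 and 2 n (6y) = 12 n
         y. *)
      rewrite (_ : 12%:R = 3%:R * 2%:R * 2%:R); last by rewrite -!natrM.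
      transitivity (3%:R * (2%:R * 'C(m.+4, 2)%:R) ^+ 2
        - 2%:R * m.+4%:R * (6%:R * 'C(m.+4, 3)%:R) : R[i]); last by ring.
      by rewrite c2 c3; ring.
    rewrite D; transitivity (12%:R * ((M * 'C(m.+4, 2)%:R) * 'C(m.+4, 2)%:R
      - (M * m.+4%:R) * 'C(m.+4, 3)%:R) : R[i]); first by ring.
    by rewrite e1 e2; ring.
  (* The sign in [M] is nonzero, and so are the positive integers in characteristic zero; only the
     value of f_n can vanish. *)
  move/eqP; rewrite !mulf_eq0 signr_eq0 !Num.Theory.pnatr_eq0 !orbF.
  by move/eqP.
have fi4 x y : fi 4 x y = 0 by rewrite hfi0.
have E a b := C _ _ _ _ _ _ a b hu hv hw.
(* The coefficients of lambda^4 and lambda^2 mu^2 give the two equalities for f_3 alone; those of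
   lambda^3, lambda mu^2, lambda^2, lambda mu, lambda and 1 give the other relations, in the order
   stated. *)
move: (E 4 0)%N (E 2 2)%N (E 3 0)%N (E 1 2)%N (E 2 0)%N (E 1 1)%N (E 1 0)%N
  (E 0 0)%N.
rewrite !(addn0, add0n, addn1, add1n, add2n, bin0, binn, bin1).
rewrite (_ : 'C(3, 2) = 3)// !(mul0r, mulr0, add0r, subr0, addr0, sub0r, fi4).
rewrite !mulr1 oppr0 addrC => e40 e22 e30 e12 e20 e11 e10 e00.
(* Both terms carry the factor 3 = C(3,1) = C(3,2), which is cancelled. *)
have {}e22 : koszul p q * fi 3 (nov u v) (alpha w) = fi 3 (nov v u) (alpha w).
  move/subr0_eq: e22; apply: mulIf.
  by rewrite Num.Theory.pnatr_eq0.
split; first by move=> i _; exact: (fi_skew hf hfE hfi0).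
split; first by rewrite -e40 e22.
split=> //; split; first by rewrite -e12; ring.
split=> //; split; first by rewrite -e11; ring.
by rewrite e10 e00.
Qed.
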